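(* For every integer $k\geq 2$, there exists a family $(D_i)_{i\in\mathbb{N}}$ of directed graphs of treewidth (at most) $k$ such that $n(D_i)=k+2+i(k+1)$ and $f(D_i)\geq (i+1)\bigl(k-2\lfloor\log_2(k)\rfloor\bigr)$.
   Context: Directed graphs are oriented graphs: finite, no loops, no multiple arcs and no pair of antiparallel arcs. $n(D)$ is the number of vertices and $f(D)$ is the minimum size of a set $F\subseteq V(D)$ such that $D-F$ contains no directed cycle. An undirected graph is a $k$-tree if it has a vertex ordering $\phi$ such that, for each vertex $v$, the set of neighbours of $v$ preceding it is a clique of size exactly $\min(k,\phi(v)-1)$. A (directed) graph has treewidth $k$ if its underlying undirected graph is a subgraph of a $k$-tree. $\mathbb{N}=\{0,1,2,\dots\}$. *)

(* Defs.v *)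
From mathcomp Require Import all_boot all_order.
From mathcomp Require Import fingroup perm.
Set Implicit Arguments. Unset Strict Implicit. Unset Printing Implicit Defensive.

(* Oriented graph: no loops, no pair of antiparallel arcs
   (multiple arcs are impossible in a relation). *)
Definition oriented (T : finType) (arc : rel T) : Prop :=
  (forall x, ~~ arc x x) /\ (forall x y, arc x y -> ~~ arc y x).

Definition induced (T : finType) (arc : rel T) (S : {set T}) : rel T :=
  [rel u v | [&& arc u v, u \in S & v \in S]].

(* fvsb arc F: F is a feedback vertex set, i.e. D - F (induced on ~: F)
   contains no directed cycle (no arc x->y with a directed path back y->x). *)
Definition fvsb (T : finType) (arc : rel T) (F : {set T}) : bool :=
  ~~ [exists x, exists y, induced arc (~: F) x y && connect (induced arc (~: F)) y x].

(* f(D): minimum size of a feedback vertex set (F = V(D) always works). *)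
Definition fvs_number (T : finType) (arc : rel T) : nat :=
  \big[minn/#|T|]_(F : {set T} | fvsb arc F) #|F|.

(* k-tree on vertex set 'I_m: simple graph with a vertex ordering phi
   (phi v = position of v, 0-indexed) such that the neighbours of v preceding
   it form a clique of size exactly min(k, phi(v)) (= min(k, 1-indexed pos - 1)). *)
Definition is_ktree (k m : nat) (e : rel 'I_m) : Prop :=
  (forall x, ~~ e x x) /\ (forall x y, e x y = e y x) /\
  exists phi : {perm 'I_m},
    forall v : 'I_m,
      let N := [set u | e u v & (phi u < phi v)%N] in
      (forall a b, a \in N -> b \in N -> a != b -> e a b) /\
      #|N| = minn k (phi v).

(* Treewidth at most k: the underlying undirected graph is a subgraph of a
   k-tree (the k-tree may have additional vertices). *)
Definition tw_le (k : nat) (T : finType) (arc : rel T) : Prop :=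
  exists (m : nat) (g : T -> 'I_m) (e : rel 'I_m),
    injective g /\ is_ktree k e /\
    (forall x y, arc x y -> e (g x) (g y)).

(* Main.v *)
From Stdlib Require Import NArith.
Require Import Defs.
From mathcomp Require Import all_boot all_order all_algebra.
From mathcomp Require Import fingroup perm.
From mathcomp Require Import ring lra zify.
Set Implicit Arguments. Unset Strict Implicit. Unset Printing Implicit Defensive.
Import Order.TTheory GRing.Theory Num.Theory.
Local Open Scope ring_scope.

(** Put N = k + 1 and b = floor(log2 k) + 1, so that N <= 2^b.  We orient
disjoint unions of pieces of the k-th power of a path, which is a k-tree, so
that induced subgraphs without directed triangles are small.  A piece on 2N
vertices can be oriented with all of them of order at most 4b - 2, and a piece
on N + 1 vertices with all of them of order at most 2b; gluing such pieces,
together with an isolated vertex when i is odd, gives D_i.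

Both orientations come from the first moment method, derandomised vertex by
vertex.  The d earlier neighbours of v inside a vertex set S form a tournament,
so among the 2^d orientations of the edges from v to them at most d + 1 create
no directed triangle: the out-neighbourhoods allowed form a chain.  Hence S is
triangle-free with probability at most the product of (d + 1) / 2^d over its
vertices.  On 2N vertices, the sum of these bounds over the sets with a vertices
in the first half and c in the second is a lattice path sum.  It is bounded by
40 q_a q_c C(2^b + c, a + c), with q_a = a! / 2^C(a,2), when b >= 11, and is
computed exactly through its Newton expansion in N when b <= 10. *)

(** * The first moment method, one vertex at a time *)

(** Sets whose traces on [A] form a chain are determined by the size of the trace, with [#|A|.+1]
    possible values, and by the part outside [A]. *)
Lemma card_chain_inter (T : finType) (A : {set T}) (p : pred {set T}) :
  (forall P Q, p P -> p Q ->
     (P :&: A \subset Q :&: A) || (Q :&: A \subset P :&: A)) ->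
  (#|[set P | p P]| * 2 ^ #|A| <= #|A|.+1 * 2 ^ #|T|)%N.
Proof.
move=> chain.
have cardA (P : {set T}) : (#|P :&: A| < #|A|.+1)%N.
  by rewrite ltnS subset_leq_card // subsetIr.
pose f (P : {set T}) : 'I_(#|A|.+1) * {set T} := (Ordinal (cardA P), P :\: A).
have inj_f : {in [set P | p P] &, injective f}.
  move=> P Q; rewrite !inE => pP pQ [eqc eqD].
  rewrite -(setID P A) -(setID Q A) eqD; congr (_ :|: _).
  by case/orP: (chain _ _ pP pQ) => sPQ; apply/eqP; [|rewrite eq_sym];
     rewrite eqEcard sPQ eqc /=.
have sub_f : f @: [set P | p P] \subset setX setT (powerset (~: A)).
  apply/subsetP=> _ /imsetP[P _ ->]; rewrite !inE /=.
  by apply/subsetP=> x; rewrite !inE => /andP[].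
have := subset_leq_card sub_f.
rewrite card_in_imset // cardsX cardsT card_ord card_powerset => le_c.
rewrite -(cardsC A) expnD mulnCA mulnC leq_mul2l expn_eq0 /=.
exact: le_c.
Qed.

Definition wt (d : nat) : rat := d.+1%:R / 2 ^+ d.

Section FirstMoment.

Variable k : nat.

(* [o v u], for u < v <= u + k, tells whether the edge uv is directed from v to u. *)
Definition orient_rel (o : rel nat) : rel nat := fun x y =>
  [&& y < x, x <= y + k & o x y]%N || [&& x < y, y <= x + k & ~~ o y x]%N.

Definition triangle_free (arc : rel nat) (S : pred nat) (m : nat) : bool :=
  [forall x : 'I_m, forall y : 'I_m, forall z : 'I_m,
     ~~ [&& S x, S y, S z, arc x y, arc y z & arc z x]].

Lemma triangle_freeP (arc : rel nat) (S : pred nat) m :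
  reflect (forall x y z, (x < m)%N -> (y < m)%N -> (z < m)%N ->
             S x -> S y -> S z -> arc x y -> arc y z -> ~~ arc z x)
          (triangle_free arc S m).
Proof.
apply: (iffP forallP) => [tf x y z xm ym zm Sx Sy Sz axy ayz | tf x].
  move/forallP/(_ (Ordinal ym))/forallP/(_ (Ordinal zm)): (tf (Ordinal xm)).
  by rewrite /= Sx Sy Sz axy ayz.
apply/forallP=> y; apply/forallP=> z; apply/negP=> /and5P[Sx Sy Sz axy].
by case/andP=> ayz; apply/negP; apply: (tf x y z).
Qed.

Definition back_degree (S : pred nat) (v : nat) : nat :=
  count S (index_iota (v - k) v).

(** [P] is the out-neighbourhood of [m] among earlier vertices. Subsets of ['I_m.+1] rather than
    ['I_m] make [inord] available; this doubles the favourable choices and all choices alike. *)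
Definition set_row (o : rel nat) m (P : {set 'I_m.+1}) : rel nat :=
  fun v u => if v == m then inord u \in P else o v u.

Lemma orient_rel_set_row o m (P : {set 'I_m.+1}) x y :
  (x < m)%N -> (y < m)%N -> orient_rel (set_row o P) x y = orient_rel o x y.
Proof. by move=> xm ym; rewrite /orient_rel /set_row !ltn_eqF. Qed.

Lemma triangle_free_set_row o m (P : {set 'I_m.+1}) S :
  triangle_free (orient_rel (set_row o P)) S m.+1 ->
  triangle_free (orient_rel o) S m.
Proof.
move/triangle_freeP=> tf; apply/triangle_freeP=> x y z xm ym zm Sx Sy Sz axy ayz.
rewrite -(orient_rel_set_row o P) //.
by apply: (tf x y z); rewrite ?orient_rel_set_row // ltnS ltnW.
Qed.

(** If neither of two admissible traces contains the other, take x in the first only and y in the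
    second only. Both lie within [k] below [m], so they are adjacent, and either direction of xy
    closes a directed triangle through [m] under one of the two choices. *)
Lemma card_triangle_free_set_row o m (S : pred nat) : S m ->
  (#|[set P : {set 'I_m.+1} |
        triangle_free (orient_rel (set_row o P)) S m.+1]|
     * 2 ^ back_degree S m <= (back_degree S m).+1 * 2 ^ m.+1)%N.
Proof.
move=> Sm.
pose A := [set u : 'I_m.+1 | [&& (u < m)%N, (m <= u + k)%N & S u]].
have cardA : #|A| = back_degree S m.
  rewrite /back_degree -sum1_count -sum1_card.
  rewrite (eq_bigl (fun u : 'I_m.+1 => (u < m)%N && (m <= u + k)%N && S u)); last first.
    by move=> u; rewrite inE andbA.
  rewrite -(big_mkord (fun u => (u < m)%N && (m <= u + k)%N && S u) (fun=> 1%N)).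
  rewrite (big_cat_nat (n := (m - k)%N)) //=; last by lia.
  rewrite big_nat_cond big1 ?add0n; last by move=> u; lia.
  rewrite big_mkcond big_nat_recr /= ?ltnn; last by lia.
  rewrite addn0 -big_mkcond big_nat_cond [RHS]big_nat_cond; apply: eq_bigl => u.
  by case: (S u); rewrite ?andbF ?andbT //; lia.
have := @card_chain_inter 'I_m.+1 A
  [pred P | triangle_free (orient_rel (set_row o P)) S m.+1].
rewrite cardA card_ord; apply=> P Q /= /triangle_freeP tfP /triangle_freeP tfQ.
apply: contraT; rewrite negb_or => /andP[/subsetPn[x xPA nxQA] /subsetPn[y yQA nyPA]].
move: xPA nxQA yQA nyPA; rewrite !inE => /andP[xP /and3P[xm xk Sx]].
rewrite xm xk Sx !andbT => xQ /andP[yQ /and3P[ym yk Sy]]; rewrite ym yk Sy !andbT => yP.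
have aP u (R : {set 'I_m.+1}) : (u < m)%N -> (m <= u + k)%N -> orient_rel (set_row o R) m u = (inord u \in R).
  by move=> um uk; rewrite /orient_rel /set_row um uk eqxx (leq_gtF (ltnW um)) orbF.
have aQ u (R : {set 'I_m.+1}) : (u < m)%N -> (m <= u + k)%N -> orient_rel (set_row o R) u m = (inord u \notin R).
  by move=> um uk; rewrite /orient_rel /set_row um uk eqxx (leq_gtF (ltnW um)).
have neq : (x : nat) != y.
  by apply: contraNneq yP => /val_inj <-.
have [axy|ayx] : orient_rel o x y \/ orient_rel o y x.
  rewrite /orient_rel; case: (ltngtP (x : nat) y) neq => // lt _.
    have -> : (y <= x + k)%N by lia.
    by case: (o y x); [right|left].
  have -> : (x <= y + k)%N by lia.
  by case: (o x y); [left|right].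
- have := tfP m x y; rewrite !ltnS leqnn !(ltnW xm) !(ltnW ym).
  move=> /(_ isT isT isT Sm Sx Sy); rewrite aP // aQ // !inord_val xP yP.
  by rewrite orient_rel_set_row // axy => /(_ isT isT).
- have := tfQ m y x; rewrite !ltnS leqnn !(ltnW xm) !(ltnW ym).
  move=> /(_ isT isT isT Sm Sy Sx); rewrite aP // aQ // !inord_val yQ xQ.
  by rewrite orient_rel_set_row // ayx => /(_ isT isT).
Qed.

Variables (n : nat) (I : eqType) (r : seq I) (S : I -> pred nat).

(* The conditional expectation of the number of triangle-free members of the
   family, once the edges inside [0, m) are oriented and the others are random. *)
Definition potential (m : nat) (o : rel nat) : rat :=
  \sum_(s <- r) (triangle_free (orient_rel o) (S s) m)%:R *
     \prod_(m <= v < n | S s v) wt (back_degree (S s) v).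

Lemma wt_gt0 d : 0 < wt d.
Proof. by rewrite divr_gt0 // ?ltr0n // exprn_gt0. Qed.

Lemma wt_ge0 d : 0 <= wt d. Proof. exact/ltW/wt_gt0. Qed.

(** The mean of the new potential over all choices for the row of [m] is at most the old potential,
    so some choice does not increase it. *)
Lemma potential_step m o : (m < n)%N ->
  exists o', potential m.+1 o' <= potential m o.
Proof.
move=> mn.
suff le_sum : \sum_(P : {set 'I_m.+1}) potential m.+1 (set_row o P)
          <= \sum_(P : {set 'I_m.+1}) potential m o.
  have [/existsP[P leP]|/existsPn ltP] :=
    boolP [exists P : {set 'I_m.+1}, potential m.+1 (set_row o P) <= potential m o].
    by exists (set_row o P).
  move: le_sum; rewrite leNgt ltr_sum //; last by move=> P _; rewrite ltNge ltP.
  by apply/hasP; exists set0; rewrite ?mem_index_enum.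
rewrite /potential exchange_big [leRHS]exchange_big /=.
elim/big_rec2: _ => // s u v _ uv; apply: lerD uv.
have cardP : #|{set 'I_m.+1}| = (2 ^ m.+1)%N.
  by rewrite -cardsT -powersetT card_powerset cardsT card_ord.
rewrite -mulr_suml sumr_const cardP [in leRHS]big_ltn_cond //.
set pr := \prod_(m.+1 <= _ < n | _) _.
have pr_ge0 : 0 <= pr by apply: prodr_ge0 => v0 _; apply: wt_ge0.
have [tf|ntf] := boolP (triangle_free (orient_rel o) (S s) m); last first.
  rewrite mul0r mul0rn big1 ?mul0r // => P _.
  by case: (boolP (triangle_free _ _ _)) => // /triangle_free_set_row; rewrite (negPf ntf).
rewrite mul1r -natr_sum.
have -> : (\sum_(P : {set 'I_m.+1}) triangle_free (orient_rel (set_row o P)) (S s) m.+1)%N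
    = #|[set P : {set 'I_m.+1} | triangle_free (orient_rel (set_row o P)) (S s) m.+1]|.
  by rewrite -sum1dep_card [RHS]big_mkcond; apply: eq_bigr => P _; case: triangle_free.
case: ifP => [Sm|_].
  rewrite -mulrnAl ler_wpM2r //.
  have := card_triangle_free_set_row o Sm.
  rewrite -(ler_nat rat) !natrM !natrX /wt => le_c.
  by rewrite -[leRHS]mulr_natr natrX mulrAC ler_pdivlMr ?exprn_gt0.
by rewrite -[leRHS]mulr_natl ler_wpM2r // ler_nat -cardP max_card.
Qed.

(** At [m = n] the potential counts the triangle-free members, and a natural number below 1 is 0. *)
Lemma first_moment : potential 0 (fun _ _ => false) < 1 ->
  exists o : rel nat, {in r, forall s, ~~ triangle_free (orient_rel o) (S s) n}.
Proof.
move=> lt1.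
have [o lo] : exists o, potential n o < 1.
  suff H m : (m <= n)%N -> exists o, potential m o < 1 by apply: (H n).
  elim: m => [|m IH] mn; first by eexists; exact: lt1.
  have [o lo] := IH (ltnW mn); have [o' lo'] := potential_step o mn.
  by exists o'; apply: le_lt_trans lo.
exists o => s rs; apply/negP=> tf; move: lo; rewrite ltNge => /negP; apply.
rewrite /potential.
under eq_bigr do rewrite big_geq // mulr1.
rewrite -natr_sum ler1n; case: (splitPr rs) => r1 r2.
by rewrite big_cat big_cons /= tf addnCA.
Qed.

End FirstMoment.

(** * Vertex sets split into two rows, and their weights *)

Definition wt_prod (a : nat) : rat := \prod_(i < a) wt i.

(* The vertices below N are listed by [s.1], those from N on by [s.2]. *)
Definition two_rows (N : nat) (s : seq bool * seq bool) : pred nat :=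
  fun v => if (v < N)%N then nth false s.1 v else nth false s.2 (v - N).

Lemma count_nth_iota (x : seq bool) m n : (m + n <= size x)%N ->
  count (nth false x) (iota m n) = count id (take n (drop m x)).
Proof.
move=> le_mn; rewrite -(@map_nth_iota _ false x m n) ?count_map //.
by rewrite leq_subRL //; lia.
Qed.

Lemma prod_wt_count_take x :
  \prod_(0 <= v < size x | nth false x v) wt (count id (take v x)) = wt_prod (count id x).
Proof.
elim/last_ind: x => [|x b IH]; first by rewrite big_nil /wt_prod big_ord0.
rewrite size_rcons big_mkcond big_nat_recr //=.
rewrite nth_rcons ltnn eqxx -cats1 count_cat take_size_cat //= addn0.
under eq_big_nat => v /andP[_ vx] do rewrite nth_cat vx takel_cat 1?ltnW //.
rewrite -big_mkcond IH; case: b => /=; last by rewrite addn0 mulr1.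
by rewrite addn1 /wt_prod big_ord_recr.
Qed.

(** Each row spans a clique, having at most [k.+1] vertices, and vertex [k.+1 + t] is adjacent to
    exactly the first-row vertices after position t; hence [drop t.+1 x]. *)
Lemma prod_wt_two_rows k x y : size x = k.+1 -> (size y <= k.+1)%N ->
  \prod_(0 <= v < k.+1 + size y | two_rows k.+1 (x, y) v)
     wt (back_degree k (two_rows k.+1 (x, y)) v) =
  wt_prod (count id x) *
  \prod_(0 <= t < size y | nth false y t)
     wt (count id (take t y) + count id (drop t.+1 x)).
Proof.
move=> sx sy; set S := two_rows _ _.
have Sx v : (v < k.+1)%N -> S v = nth false x v by rewrite /S /two_rows => ->.
have Sy v : S (k.+1 + v)%N = nth false y v.
  by rewrite /S /two_rows ltnNge leq_addr /= addKn.
rewrite (big_cat_nat (n := k.+1)) ?leq_addr //=; congr (_ * _).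
  rewrite -prod_wt_count_take sx big_nat_cond [RHS]big_nat_cond.
  apply: eq_big => v; first by case: ltnP => //= /Sx ->.
  move=> /andP[/andP[_ vk] _]; congr wt; rewrite /back_degree.
  have -> : (v - k = 0)%N by lia.
  rewrite -(drop0 x) -count_nth_iota; last by lia.
  rewrite /index_iota subn0.
  by apply: eq_in_count => u; rewrite mem_iota => uv; rewrite Sx //; lia.
rewrite -{1}[k.+1]add0n [(k.+1 + size y)%N]addnC big_addn addnK.
rewrite big_nat_cond [RHS]big_nat_cond; apply: eq_big => v.
  by rewrite addnC Sy.
move=> /andP[/andP[_ vk] _]; congr wt; rewrite /back_degree /index_iota.
have -> : (v + k.+1 - k = v.+1)%N by lia.
have -> : (v + k.+1 - v.+1 = (k - v) + v)%N by lia.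
rewrite iotaD count_cat addnC; congr (_ + _)%N.
  rewrite -{1}(drop0 y) -count_nth_iota; last by lia.
  have -> : (v.+1 + (k - v) = k.+1 + 0)%N by lia.
  by rewrite iotaDl count_map; apply: eq_count => u /=; rewrite Sy.
rewrite -[drop _ _](take_oversize (n := (k - v)%N)); last by rewrite size_drop; lia.
rewrite -count_nth_iota; last by lia.
by apply: eq_in_count => u; rewrite mem_iota => uv; rewrite Sx //; lia.
Qed.

Fixpoint row_pairs (n : nat) : seq (seq bool * seq bool) :=
  if n is n'.+1 then
    [seq (rcons s.1 p.1, rcons s.2 p.2) | s <- row_pairs n',
       p <- [:: (false, false); (true, false); (false, true); (true, true)]]
  else [:: ([::], [::])].

Lemma size_row_pairs n s : s \in row_pairs n -> size s.1 = n /\ size s.2 = n.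
Proof.
elim: n s => [|n IH] s; first by rewrite inE => /eqP ->.
by case/allpairsPdep=> [s' [p [/IH[s1 s2] _ ->]]] /=; rewrite !size_rcons s1 s2.
Qed.

Lemma mem_row_pairs n x y : size x = n -> size y = n -> (x, y) \in row_pairs n.
Proof.
elim: n x y => [|n IH] x y; first by move/size0nil=> -> /size0nil ->.
case/lastP: x => [//|x b]; case/lastP: y => [//|y c]; rewrite !size_rcons.
move=> [sx] [sy]; apply/allpairsPdep; exists (x, y), (b, c); split=> //.
  exact: IH.
by case: b; case: c.
Qed.

(** This is the second-row factor of [prod_wt_two_rows] when the first row has [a] entries. Writing
    a suffix count as [a] minus a prefix count lets it be computed by appending columns. *)
Definition row_wt (a : nat) (s : seq bool * seq bool) : rat :=
  \prod_(0 <= t < size s.2 | nth false s.2 t)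
     wt (count id (take t s.2) + (a - count id (take t.+1 s.1))).

Lemma row_wt_rcons a x y b c : size x = size y ->
  row_wt a (rcons x b, rcons y c) =
  row_wt a (x, y) * (if c then wt (count id y + (a - (count id x + b))) else 1).
Proof.
move=> sxy; rewrite /row_wt /= size_rcons big_mkcond big_nat_recr //=.
rewrite nth_rcons ltnn eqxx -!cats1 take_size_cat // -sxy.
rewrite take_oversize ?size_cat ?addn1 // count_cat /= addn0.
congr (_ * _); rewrite [RHS]big_mkcond; apply: eq_big_nat => v /andP[_ vx].
by rewrite nth_cat -sxy vx !takel_cat // -?sxy // ltnW.
Qed.

(* Vertex N + t is adjacent to vertex u < N exactly when u > t, so when the t-th
   columns are read, i of the a entries of the first row are already known to be
   non-adjacent to it. *)
Fixpoint row_sum (a t i j : nat) : rat :=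
  if t is t'.+1 then
    row_sum a t' i j + (if i is i'.+1 then row_sum a t' i' j else 0) +
    (if j is j'.+1 then
       wt (j' + (a - i)) *
       (row_sum a t' i j' + (if i is i'.+1 then row_sum a t' i' j' else 0))
     else 0)
  else ((i == 0%N) && (j == 0%N))%:R.

Lemma sum_row_wt a t i j :
  \sum_(s <- row_pairs t | (count id s.1 == i) && (count id s.2 == j)) row_wt a s
  = row_sum a t i j.
Proof.
elim: t i j => [|t IH] i j.
  rewrite /= big_mkcond big_seq1 /= /row_wt big_nil.
  by case: i j => [|i] [|j].
rewrite big_mkcond big_allpairs_dep.
(* [F s b c] is the contribution of the pairs whose last column is [(b, c)]. *)
pose F s (b c : bool) := if (count id s.1 + b == i)%N && (count id s.2 + c == j)%N
   then row_wt a s * (if c then wt (count id s.2 + (a - (count id s.1 + b))) else 1) else 0.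
rewrite (eq_big_seq (fun s => F s false false + F s true false + F s false true + F s true true)); last first.
  move=> s /size_row_pairs [s1 s2]; rewrite !big_cons big_nil /= addr0 !addrA.
  case: s s1 s2 => x y /= s1 s2.
  rewrite /F /=; congr (_ + _ + _ + _); rewrite row_wt_rcons ?s1 ?s2 // -!cats1 !count_cat /= !addn0 //.
rewrite !big_split /=.
have F00 : \sum_(s <- row_pairs t) F s false false = row_sum a t i j.
  by rewrite -IH [RHS]big_mkcond; apply: eq_bigr => s _; rewrite /F !addn0 mulr1.
have F10 : \sum_(s <- row_pairs t) F s true false = if i is i'.+1 then row_sum a t i' j else 0.
  case: i @F {F00} => [|i] F; first by rewrite big1 // => s _; rewrite /F addn1.
  by rewrite -IH [RHS]big_mkcond; apply: eq_bigr => s _; rewrite /F addn0 addn1 eqSS mulr1.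
have F01 : \sum_(s <- row_pairs t) F s false true =
   if j is j'.+1 then wt (j' + (a - i)) * row_sum a t i j' else 0.
  case: j @F {F00 F10} => [|j] F; first by rewrite big1 // => s _; rewrite /F addn1 andbF.
  rewrite -IH mulr_sumr [RHS]big_mkcond; apply: eq_bigr => s _; rewrite /F addn0 addn1 eqSS.
  by case: ifP => // /andP[/eqP-> /eqP->]; rewrite mulrC.
have F11 : \sum_(s <- row_pairs t) F s true true =
   if j is j'.+1 then wt (j' + (a - i)) * (if i is i'.+1 then row_sum a t i' j' else 0) else 0.
  case: j @F {F00 F10 F01} => [|j] F; first by rewrite big1 // => s _; rewrite /F !addn1 andbF.
  case: i @F => [|i] F; first by rewrite mulr0 big1 // => s _; rewrite /F !addn1.
  rewrite -IH mulr_sumr [RHS]big_mkcond; apply: eq_bigr => s _; rewrite /F !addn1 !eqSS.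
  by case: ifP => // /andP[/eqP-> /eqP->]; rewrite mulrC.
rewrite F00 F10 F01 F11 /=; case: (j) => [|j']; first by rewrite !addr0.
by rewrite mulrDr !addrA.
Qed.

Lemma sub_mask_count (x : seq bool) a : (a <= count id x)%N ->
  exists2 x', size x' = size x & count id x' = a /\
     forall v, nth false x' v -> nth false x v.
Proof.
elim: x a => [|b x IH] a /=; first by rewrite leqn0 => /eqP ->; exists [::].
case: b a => [[|a]|a] /= le_a.
- have [x' sx' [cx' nx']] := IH 0%N isT.
  by exists (false :: x'); rewrite /= ?sx' //; split=> // [[|v]] //= /nx'.
- have [x' sx' [cx' nx']] := IH a le_a.
  by exists (true :: x'); rewrite /= ?sx' ?cx' //; split=> // [[|v]] //= /nx'.
- have [x' sx' [cx' nx']] := IH a le_a.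
  by exists (false :: x'); rewrite /= ?sx' //; split=> // [[|v]] //= /nx'.
Qed.

Lemma sub_triangle_free (arc : rel nat) (S T : pred nat) n :
  (forall v, (v < n)%N -> S v -> T v) -> triangle_free arc T n -> triangle_free arc S n.
Proof.
move=> ST /triangle_freeP tf; apply/triangle_freeP=> x y z xn yn zn Sx Sy Sz.
by apply: tf => //; apply: ST.
Qed.

Lemma sub_two_rows N l (T : pred nat) a c :
  (a <= count T (iota 0 N))%N -> (c <= count T (iota N l))%N ->
  exists x y, [/\ size x = N, size y = l, count id x = a, count id y = c &
     forall v, (v < N + l)%N -> two_rows N (x, y) v -> T v].
Proof.
rewrite -(count_map T id) -[count T (iota N l)](count_map T id).
move=> /sub_mask_count[x sx [cx nx]] /sub_mask_count[y sy [cy ny]].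
exists x, y; rewrite sx sy !size_map !size_iota; split=> // v vN.
rewrite /two_rows /=; case: ltnP => [vx|Nv].
  by move/nx; rewrite (nth_map 0%N) ?size_iota // nth_iota.
by move/ny; rewrite (nth_map 0%N) ?size_iota ?nth_iota; rewrite ?subnKC //; lia.
Qed.

(** Excluding sets with exactly the listed counts is enough: a triangle-free set with larger counts
    can be thinned out to them by [sub_two_rows]. *)
Lemma first_moment_two_rows k (r : seq (nat * nat)) :
  \sum_(f <- r) wt_prod f.1 * row_sum f.1 k.+1 f.1 f.2 < 1 ->
  exists o, forall T, triangle_free (orient_rel k o) T (k.+1 + k.+1) ->
    {in r, forall f, (f.1 <= count T (iota 0 k.+1))%N ->
                     (count T (iota k.+1 k.+1) < f.2)%N}.
Proof.
move=> lt1.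
pose fam (f : nat * nat) := [seq s <- row_pairs k.+1 | (count id s.1 == f.1) && (count id s.2 == f.2)].
have [|o Ho] := @first_moment k (k.+1 + k.+1) _ (flatten (map fam r)) (two_rows k.+1).
  apply: le_lt_trans lt1; rewrite /potential big_flatten big_map le_eqVlt.
  apply/orP; left; apply/eqP; apply: eq_bigr => f _.
  rewrite big_filter -sum_row_wt mulr_sumr big_seq_cond [RHS]big_seq_cond.
  apply: eq_bigr => -[x y] /and3P[/size_row_pairs[/= sx sy] /eqP/= cx _].
  have -> : triangle_free (orient_rel k (fun _ _ => false)) (two_rows k.+1 (x, y)) 0.
    by apply/triangle_freeP.
  rewrite mul1r -{2}sy prod_wt_two_rows ?sy // cx; congr (_ * _).
  rewrite /row_wt /= sy big_nat_cond [RHS]big_nat_cond; apply: eq_bigr => t _; congr (wt (_ + _)).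
  by rewrite -cx -{2}(cat_take_drop t.+1 x) count_cat addKn.
exists o => T tf f rf le1; rewrite ltnNge; apply/negP=> le2.
have [x [y [sx sy cx cy sub]]] := sub_two_rows le1 le2.
suff mem_xy : (x, y) \in flatten (map fam r).
  by have /negP := Ho _ mem_xy; apply; apply: sub_triangle_free sub tf.
apply/flattenP; exists (fam f); first exact: map_f.
by rewrite mem_filter mem_row_pairs //= cx cy !eqxx.
Qed.

Lemma row_sum0 a t i : row_sum a t i 0 = 'C(t, i)%:R.
Proof.
elim: t i => [|t IH] [|i] //=; rewrite addr0 IH ?addr0 ?bin0 //.
by rewrite IH -natrD binS.
Qed.

Lemma wt_anti d e : (d <= e)%N -> wt e <= wt d.
Proof.
elim: e => [|e IH]; first by rewrite leqn0 => /eqP ->.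
rewrite leq_eqVlt => /orP[/eqP-> //|]; rewrite ltnS => /IH; apply: le_trans.
rewrite /wt exprS invfM mulrA ler_wpM2r ?invr_ge0 ?exprn_ge0 //.
by rewrite ler_pdivrMr // -natrM ler_nat; lia.
Qed.

(** A set of s + 2 vertices either lies in the first row or has s + 1 vertices there plus the last
    vertex, which is adjacent to all of the row but vertex 0 and so has back degree at least s. *)
Lemma first_moment_row_point k s :
  'C(k.+1, s.+2)%:R * wt_prod s.+2 + 'C(k.+1, s.+1)%:R * (wt_prod s.+1 * wt s) < 1 ->
  exists o, forall T, triangle_free (orient_rel k o) T (k.+1 + 1) ->
    (count T (iota 0 (k.+1 + 1)) < s.+2)%N.
Proof.
move=> lt1.
(* The all-false second row lets [row_sum0] count the first rows with i entries. *)
pose fam (i : nat) (c : bool) := [seq (p.1, [:: c]) | p <- row_pairs k.+1 & (count id p.1 == i) && (count id p.2 == 0%N)].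
have famP i c x : size x = k.+1 -> count id x = i -> (x, [:: c]) \in fam i c.
  move=> sx cx; apply/mapP; exists (x, nseq k.+1 false) => //.
  by rewrite mem_filter mem_row_pairs ?size_nseq // cx count_nseq !eqxx.
have le_fam i c M : (forall x, size x = k.+1 -> count id x = i ->
     \prod_(0 <= t < 1 | nth false [:: c] t)
       wt (count id (take t [:: c]) + count id (drop t.+1 x)) <= M) ->
    \sum_(p <- fam i c) (triangle_free (orient_rel k (fun _ _ => false)) (two_rows k.+1 p) 0)%:R *
     \prod_(0 <= v < k.+1 + 1 | two_rows k.+1 p v) wt (back_degree k (two_rows k.+1 p) v)
    <= 'C(k.+1, i)%:R * (wt_prod i * M).
  move=> leM; rewrite big_map big_filter -(row_sum0 0) -sum_row_wt mulr_suml.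
  rewrite big_seq_cond [leRHS]big_seq_cond; apply: ler_sum => -[x y] /and3P[/size_row_pairs[sx sy] /eqP cx /eqP cy].
  have -> : row_wt 0 (x, y) = 1.
    rewrite /row_wt big1_seq //= => t /andP[yt]; rewrite mem_index_iota sy => /andP[_ tk].
    have : has id y by apply/(has_nthP false); exists t; rewrite ?sy.
    by rewrite has_count cy.
  rewrite mul1r; have -> : triangle_free (orient_rel k (fun _ _ => false)) (two_rows k.+1 (x, [:: c])) 0.
    by apply/triangle_freeP.
  rewrite mul1r (prod_wt_two_rows (y := [:: c])) //= cx ler_wpM2l ?leM //.
  by apply: prodr_ge0 => j _; apply: wt_ge0.
have [|o Ho] := @first_moment k (k.+1 + 1) _ (fam s.+2 false ++ fam s.+1 true) (two_rows k.+1).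
  apply: le_lt_trans lt1; rewrite /potential big_cat; apply: lerD.
    rewrite -[wt_prod s.+2]mulr1; apply: le_fam => x _ _.
    by rewrite big_mkcond big_nat1.
  apply: le_fam => x sx cx; rewrite big_mkcond big_nat1 /=; apply: wt_anti.
  by case: x sx cx => // b x _ /=; rewrite drop0; case: b => /=; lia.
exists o => T tf; rewrite ltnNge; apply/negP; rewrite iotaD count_cat => le_c.
have [le_s|gt_s] := leqP s.+2 (count T (iota 0 k.+1)).
  have [x [y [sx sy cx cy sub]]] := sub_two_rows (l := 1) le_s (leq0n _).
  have yE : y = [:: false] by case: y sy cy {sub} => [|[] []].
  have mem_xy : (x, y) \in fam s.+2 false ++ fam s.+1 true by rewrite mem_cat yE famP.
  by have /negP := Ho _ mem_xy; apply; apply: sub_triangle_free sub tf.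
have := count_size T (iota k.+1 1); rewrite size_iota => ge_1.
rewrite add0n in le_c.
have le_s : (s.+1 <= count T (iota 0 k.+1))%N by lia.
have le_1 : (1 <= count T (iota k.+1 1))%N by lia.
have [x [y [sx sy cx cy sub]]] := sub_two_rows le_s le_1.
have yE : y = [:: true] by case: y sy cy {sub} => [|[] []].
have mem_xy : (x, y) \in fam s.+2 false ++ fam s.+1 true.
  by rewrite mem_cat yE [X in _ || X]famP ?orbT.
by have /negP := Ho _ mem_xy; apply; apply: sub_triangle_free sub tf.
Qed.

(** * Estimates for factorials, powers and central binomials *)

Lemma wt_prodS a : wt_prod a.+1 = wt_prod a * wt a.
Proof. by rewrite /wt_prod big_ord_recr. Qed.

Lemma wt_prod_gt0 a : 0 < wt_prod a.
Proof. by apply: prodr_gt0 => i _; apply: wt_gt0. Qed.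

Lemma wt_prodE a : wt_prod a = a`!%:R / 2 ^+ 'C(a, 2).
Proof.
elim: a => [|a IH]; first by rewrite /wt_prod big_ord0 divr1.
rewrite wt_prodS IH /wt factS natrM binS bin1 exprD.
by field; rewrite !expf_neq0.
Qed.

Lemma ffact_le_expn x n y : (2 * x + 1 <= n + 2 * y -> x ^_ n <= y ^ n)%N.
Proof.
elim/ltn_ind: n x => -[|[|n]] IH x le_xy; first by rewrite ffactn0.
  by rewrite ffactn1 expn1; lia.
case: x le_xy => [|x] le_xy; first by rewrite ffact0n.
rewrite ffactSS ffactnSr mulnCA -addn2 expnD.
have [lt_xn|le_nx] := ltnP x n; first by rewrite (_ : (x - n)%N = 0%N) ?muln0 //; lia.
by apply: leq_mul; [apply: IH; lia | rewrite -mulnn; nia].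
Qed.

(** Bernoulli's inequality gives (N / (N + 2))^n >= 1 - 2n / (N + 2) >= 10 / 11. *)
Lemma expn_add2_le N n : (22 * n <= N + 2 -> 10 * (N + 2) ^ n <= 11 * N ^ n)%N.
Proof.
have bern m : ((N + 2) ^ m * (N + 2) <= N ^ m * (N + 2) + 2 * m * (N + 2) ^ m)%N.
  elim: m => [|m IH]; first by rewrite !expn0; lia.
  by rewrite !expnS; nia.
move=> le_n; have := bern n; set A := ((N + 2) ^ n)%N; set B := (N ^ n)%N.
by nia.
Qed.

Lemma central_binS n : (n.+1 * 'C(2 * n.+1, n.+1) = 2 * (2 * n + 1) * 'C(2 * n, n))%N.
Proof.
have E1 := mul_bin_diag (2 * n.+1) n; have E2 := mul_bin_down (2 * n + 1) n.
rewrite (_ : (2 * n.+1).-1 = 2 * n + 1)%N in E1; last by lia.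
rewrite (_ : (2 * n + 1).-1 = 2 * n)%N in E2; last by lia.
rewrite (_ : (2 * n + 1 - n = n.+1)%N) in E2; last by lia.
by rewrite -E1 -!mulnA E2.
Qed.

(** By [central_binS], the induction step amounts to (2n + 1)^2 >= 4n(n + 1). *)
Lemma central_bin_sqr_ge n : (0 < n -> 16 ^ n <= 4 * n * 'C(2 * n, n) ^ 2)%N.
Proof.
case: n => // n _; elim: n => [|n IH] //.
have := central_binS n.+1.
rewrite -(leq_pmul2l (ltn0Sn n.+1)) expnS.
move: IH; set D := 'C(2 * n.+1, n.+1); set D' := 'C(2 * n.+2, n.+2); set X := (16 ^ n.+1)%N.
move=> IH E.
have -> : (n.+2 * (4 * n.+2 * D' ^ 2) = 4 * (n.+2 * D') ^ 2)%N by ring.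
by rewrite E; nia.
Qed.

Lemma central_bin_ge b : (8 <= b -> 16 ^ b <= b * 'C(4 * b, 2 * b))%N.
Proof.
(* At 2b the previous bound has the factor 8b, which is at most b^2 because b >= 8. *)
move=> b8; have b0 : (0 < 2 * b)%N by lia.
have := central_bin_sqr_ge b0.
rewrite (_ : 2 * (2 * b) = 4 * b)%N; last by lia.
rewrite (_ : 16 ^ (2 * b) = (16 ^ b) ^ 2)%N; last by rewrite mulnC expnM.
move=> le_sqr; rewrite -leq_sqr expnMn; apply: leq_trans le_sqr _.
by rewrite leq_mul2r; apply/orP; right; nia.
Qed.

(** * Bounding the lattice path sum by a supersolution *)

Lemma row_sum_ge0 a t i j : 0 <= row_sum a t i j.
Proof.
elim: t i j => [|t IH] i j /=; first exact: ler0n.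
apply: addr_ge0; first by apply: addr_ge0 => //; case: i.
by case: j => // j; rewrite mulr_ge0 ?wt_ge0 ?addr_ge0 //; case: i.
Qed.

Lemma row_sum_mono a t t' i j : (t <= t')%N -> row_sum a t i j <= row_sum a t' i j.
Proof.
move/subnK<-; elim: (t' - t)%N => // d IH; rewrite addSn /=.
apply: le_trans IH _; rewrite -addrA lerDl addr_ge0 //.
  by case: i => // i; apply: row_sum_ge0.
case: j => // j; rewrite mulr_ge0 ?wt_ge0 ?addr_ge0 ?row_sum_ge0 //.
by case: i => // i; apply: row_sum_ge0.
Qed.

Section Supersolution.

Variables (a : nat) (B : nat -> nat -> rat).
Hypothesis B00 : 1 <= B 0 0.
Hypothesis B_ge0 : forall i j, 0 <= B i j.
Hypothesis B_super : forall i j, (i <= a)%N ->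
  (if i is i'.+1 then B i' j else 0) +
  (if j is j'.+1 then wt (j' + (a - i)) * B i j' else 0) <= B i j.

(* A word with i x's and j y's comes from at most 'C(t + j, i + j) pairs of
   rows of length t: equality of types is allowed only from an x to a y. *)
Lemma row_sum_le_super t i j : (i <= a)%N ->
  row_sum a t i j <= B i j * 'C(t + j, i + j)%:R.
Proof.
elim: t i j => [|t IH] i j ia.
  rewrite /= add0n; have [->|/= ?] := eqVneq i 0%N; last by rewrite mulr_ge0.
  by case: j => [|j]; rewrite /= ?mulr1 // mulr_ge0.
have B_mono i' j' : (i'.+1 <= a)%N -> B i' j' <= B i'.+1 j'.
  move=> ia'; apply: le_trans (B_super j' ia'); rewrite lerDl.
  by case: j' => // j'; rewrite mulr_ge0 ?wt_ge0.
have Sup := B_super j ia.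
case: i j ia Sup => [|i] [|j] ia Sup /=.
- by rewrite !addr0 !bin0; have := IH 0%N 0%N isT; rewrite bin0.
- rewrite !addr0 add0r in Sup *; rewrite add0n addSn binS natrD mulrDr.
  apply: lerD; first exact: (IH 0%N j.+1).
  apply: le_trans (ler_wpM2r (ler0n _ _) Sup); rewrite -[leRHS]mulrA ler_wpM2l ?wt_ge0 //.
  apply: le_trans (IH 0%N j isT) _; rewrite ler_wpM2l // ler_nat.
  by rewrite addnS leq_bin2l.
- rewrite !addr0 in Sup *; rewrite !addn0 binS natrD mulrDr.
  apply: lerD; first by have := IH i.+1 0%N ia; rewrite !addn0.
  apply: le_trans (ler_wpM2r (ler0n _ _) Sup).
  by have := IH i 0%N (ltnW ia); rewrite !addn0.
- have H11 := IH i.+1 j.+1 ia; have H01 := IH i j.+1 (ltnW ia).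
  have H10 := IH i.+1 j ia; have H00 := IH i j (ltnW ia).
  rewrite [(t.+1 + _)%N]addSn [(i.+1 + _)%N]addSn binS natrD [leRHS]mulrDr -[leLHS]addrA.
  rewrite [(i.+1 + _)%N]addSn in H11; rewrite lerD // {H11}.
  apply: le_trans (ler_wpM2r (ler0n _ _) Sup); rewrite mulrDl lerD // {H01} -[leRHS]mulrA.
  rewrite ler_wpM2l ?wt_ge0 // !addnS binS natrD mulrDr lerD //.
  apply: le_trans H00 _; rewrite ler_wpM2r //; exact: B_mono.
Qed.

End Supersolution.

(* Bounds wt (d + m) / wt d for d >= 1. *)
Definition ratio (m : nat) : rat := (m.+2)%:R / 2 ^+ m.+1.

Lemma ratio_ge0 m : 0 <= ratio m.
Proof. by rewrite divr_ge0 ?exprn_ge0. Qed.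

Lemma wt_add_le m d : wt (d.+1 + m) <= wt d.+1 * ratio m.
Proof.
rewrite /wt /ratio mulrACA -invfM -exprD ler_pdivrMr ?exprn_gt0 //.
rewrite (_ : (d.+1 + m.+1)%N = (d.+1 + m).+1) ?addnS // exprS invfM.
rewrite -[X in _ <= X]mulrA [X in _ * X]mulrAC -mulrA divff ?expf_neq0 // mulr1.
by rewrite ler_pdivlMr // -!natrM ler_nat; nia.
Qed.

Lemma wt_le_ratio m : wt m <= 2 * ratio m.
Proof.
have -> : 2 * ratio m = m.+2%:R / 2 ^+ m.
  by rewrite /ratio exprS; field; rewrite expf_neq0.
by rewrite ler_wpM2r ?invr_ge0 ?exprn_ge0 // ler_nat.
Qed.

(** The complete homogeneous symmetric polynomial of degree j in [ratio a], [ratio (a - 1)], ...,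
    [ratio (a - i)]. *)
Fixpoint homog (a i : nat) : nat -> rat :=
  if i is i'.+1 then
    fix f j := homog a i' j + (if j is j'.+1 then ratio (a - i) * f j' else 0)
  else fun j => ratio a ^+ j.

Lemma homogS a i j : homog a i.+1 j =
  homog a i j + (if j is j'.+1 then ratio (a - i.+1) * homog a i.+1 j' else 0).
Proof. by case: j. Qed.

Lemma homog0 a i : homog a i 0 = 1.
Proof. by elim: i => [|i IH]; rewrite ?homogS ?IH ?addr0 // expr0. Qed.

Lemma homog_ge0 a i j : 0 <= homog a i j.
Proof.
elim: i j => [|i IHi] j; first exact/exprn_ge0/ratio_ge0.
elim: j => [|j IHj]; first by rewrite homog0.
by rewrite homogS addr_ge0 // mulr_ge0 ?ratio_ge0.
Qed.

(* From 5 on, (m + 3) / 2^m is the tail sum of [ratio]; the first values are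
   chosen so that [homog_bound_step] holds. *)
Definition homog_bound (m : nat) : rat :=
  if (m <= 4)%N then nth 0 [:: 0; 20; 5; 5 / 2; 5 / 3] m
  else 1 + 4 / 3 * (m + 3)%:R / 2 ^+ m.

Lemma homog_bound_ge1 m : (0 < m)%N -> 1 <= homog_bound m.
Proof.
rewrite /homog_bound; case: (leqP m 4) => [|_ _]; last first.
  by rewrite lerDl !mulr_ge0 ?invr_ge0 ?exprn_ge0.
by case: m => [|[|[|[|[|m]]]]] //= _ _; lra.
Qed.

Lemma tail_le m : (5 <= m)%N -> (m + 3)%:R / 2 ^+ m <= 1 / 4 :> rat.
Proof.
move=> m5; rewrite ler_pdivrMr ?exprn_gt0 // mulrC mulrA mulr1 ler_pdivlMr ?ltr0n //.
rewrite -natrM -natrX ler_nat.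
move: m5 => /subnK <-; elim: (m - 5)%N => [|d IH] //.
by rewrite addSn expnS; lia.
Qed.

Lemma homog_bound_small (R : realFieldType) :
  [/\ 5 + 3 / 4 * 20 <= 20 :> R, 5 / 2 + 1 / 2 * 5 <= 5 :> R,
      5 / 3 + 5 / 16 * (5 / 2) <= 5 / 2 :> R & 4 / 3 + 3 / 16 * (5 / 3) <= 5 / 3 :> R].
Proof. split; lra. Qed.

Lemma homog_bound_step m : (0 < m)%N ->
  homog_bound m.+1 + ratio m * homog_bound m <= homog_bound m.
Proof.
case: (leqP m 4) => [|m5 _].
  have r1 : ratio 1 = 3 / 4 by rewrite /ratio; field.
  have r2 : ratio 2 = 1 / 2 by rewrite /ratio; field.
  have r3 : ratio 3 = 5 / 16 by rewrite /ratio; field.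
  have r4 : ratio 4 = 3 / 16 by rewrite /ratio; field.
  have h5 : homog_bound 5 = 4 / 3 by rewrite /homog_bound; field.
  have [i1 i2 i3 i4] := homog_bound_small rat.
  have [->|m1] := eqVneq m 1%N; first by rewrite r1.
  have [->|m2] := eqVneq m 2%N; first by rewrite r2.
  have [->|m3] := eqVneq m 3%N; first by rewrite r3.
  have [->|m4] := eqVneq m 4%N; first by rewrite r4 h5.
  by lia.
rewrite /homog_bound [(m <= 4)%N]leqNgt m5 [(m.+1 <= 4)%N]leqNgt ltnS (ltnW m5) /=.
have := tail_le m5; rewrite /ratio !exprS !invfM.
have -> : (m.+1 + 3)%:R = (m + 3)%:R + 1 :> rat by rewrite addSn -natr1.
have -> : m.+2%:R = (m + 3)%:R - 1 :> rat by rewrite addn3 -[m.+3%:R]natr1 addrK.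
have := exprn_gt0 m (isT : 0 < 2 :> rat); rewrite -invr_gt0.
have : 1 <= (m + 3)%:R :> rat by rewrite ler1n addn3.
move: (m + 3)%:R (2 ^+ m)^-1 => M e M1 e0 Me.
(* With M = m + 3 and e = 1 / 2^m, the slack in the inequality is exactly 2/3 of this product, and
   [tail_le] makes its last factor nonnegative. *)
have key : 0 <= (M - 1) * e * (1 / 4 - M * e).
  by rewrite !mulr_ge0 ?subr_ge0 // ltW.
rewrite -subr_ge0; rewrite (_ : _ - _ = 2 / 3 * ((M - 1) * e * (1 / 4 - M * e))); last by field.
by apply: mulr_ge0 key; rewrite divr_ge0 ?ler0n.
Qed.

(** The sum over all degrees is the product of 1 / (1 - [ratio l]) for a - i <= l <= a, and
    [homog_bound_step] absorbs one factor at a time. *)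
Lemma sum_homog_le a i j : (i < a)%N ->
  \sum_(l < j.+1) homog a i l <= homog_bound (a - i).
Proof.
elim: i j => [|i IHi] j ia.
  rewrite subn0; have K1 := homog_bound_ge1 ia; have K2 := homog_bound_step ia.
  have K3 := @homog_bound_ge1 a.+1 isT.
  elim: j => [|j IHj]; first by rewrite big_ord1 homog0.
  rewrite big_ord_recl homog0.
  under eq_bigr => l _ do rewrite /= exprS -[ratio a ^+ l]/(homog a 0 l).
  rewrite -mulr_sumr; have := ler_wpM2l (ratio_ge0 a) IHj; lra.
have ai : (0 < a - i.+1)%N by lia.
have K2 := homog_bound_step ai.
have aiE : (a - i)%N = (a - i.+1).+1 by lia.
elim: j => [|j IHj]; first by rewrite big_ord1 homog0 homog_bound_ge1.
under eq_bigr => l _ do rewrite homogS.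
rewrite big_split /= [X in _ + X]big_ord_recl /= add0r -mulr_sumr.
have := ler_wpM2l (ratio_ge0 (a - i.+1)) IHj.
have := IHi j.+1 (ltnW ia); rewrite aiE; lra.
Qed.

(** As [ratio 0] is 1, adjoining it as a variable sums the lower degrees. This reduces the case of
    equal indices, where the full series diverges, to [sum_homog_le]. *)
Lemma homog_diag a j : homog a.+1 a.+1 j = \sum_(l < j.+1) homog a.+1 a l.
Proof.
elim: j => [|j IH]; first by rewrite big_ord1 !homog0.
have r0 : ratio 0 = 1 by rewrite /ratio; field.
rewrite homogS subnn r0.
by rewrite mul1r IH [RHS]big_ord_recr [RHS]addrC.
Qed.

Lemma row_sum_le a c t : (0 < a)%N -> (0 < c)%N ->
  row_sum a t a c <= 40 * wt_prod c * 'C(t + c, a + c)%:R.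
Proof.
move=> a0 c0.
(* The factor 2 for j > 0 pays for the first y, where only [wt_le_ratio] applies; later ones use
   [wt_add_le]. With [homog_bound 1 = 20] this gives the constant 40. *)
pose B i j := (j > 0)%N.+1%:R * wt_prod j * homog a i j.
have B_ge0 i j : 0 <= B i j.
  by rewrite /B !mulr_ge0 ?homog_ge0 // ltW // wt_prod_gt0.
have Hsup : forall i j, (i <= a)%N ->
  (if i is i'.+1 then B i' j else 0) +
  (if j is j'.+1 then wt (j' + (a - i)) * B i j' else 0) <= B i j.
  move=> i j ia.
  suff H : (if j is j'.+1 then wt (j' + (a - i)) * B i j' else 0) <=
     (j > 0)%N.+1%:R * wt_prod j * (if j is j'.+1 then ratio (a - i) * homog a i j' else 0).
    case: i ia H => [|i] ia H.
      rewrite add0r; case: j H => [|j] H; first exact: B_ge0.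
      by apply: le_trans H _; rewrite subn0 /B /= exprS.
    by rewrite [leRHS]/B homogS mulrDr lerD.
  case: j => [|j]; first by rewrite mulr0.
  rewrite /B /= wt_prodS; case: j => [|j] /=.
    have w0 : wt 0 = 1 by rewrite /wt expr0 divr1.
    have q0 : wt_prod 0 = 1 by rewrite /wt_prod big_ord0.
    by rewrite w0 q0 homog0 add0n !mulr1; apply: wt_le_ratio.
  have := wt_add_le (a - i) j.
  have := mulr_ge0 (ltW (wt_prod_gt0 j.+1)) (homog_ge0 a i j.+1).
  set u := wt_prod _; set h := homog _ _ _; set w := wt (_ + _); set w' := wt _; set r := ratio _.
  by nra.
have B00 : 1 <= B 0 0 by rewrite /B homog0 /wt_prod big_ord0 !mulr1.
apply: le_trans (row_sum_le_super B00 B_ge0 Hsup t c (leqnn a)) _.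
apply: ler_wpM2r; first exact: ler0n.
rewrite /B c0 mulrAC; apply: ler_wpM2r; first exact/ltW/wt_prod_gt0.
case: a a0 {B B_ge0 Hsup B00} => [a0|a _]; first by exfalso; rewrite ltnn in a0.
rewrite homog_diag.
have := @sum_homog_le a.+1 a c (ltnSn a); rewrite subSnn /homog_bound /=; lra.
Qed.

(** * The moment inequality for k + 2 vertices, and for 2(k + 1) vertices with large b *)

Lemma bin2_mul2 n : ('C(n, 2) * 2 = n * n.-1)%N.
Proof. by have := bin_ffact n 2; rewrite ffactnS ffactn1. Qed.

Lemma bin2_even m : ('C(2 * m.+1, 2) = m.+1 * (2 * m + 1))%N.
Proof.
apply/eqP; rewrite -(eqn_pmul2r (ltn0Sn 1)) bin2_mul2; apply/eqP.
by rewrite (_ : (2 * m.+1).-1 = 2 * m + 1)%N; [ring|lia].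
Qed.

Lemma bin2_odd m : ('C(2 * m + 1, 2) = m * (2 * m + 1))%N.
Proof.
by apply/eqP; rewrite -(eqn_pmul2r (ltn0Sn 1)) bin2_mul2 addn1 /=; apply/eqP; ring.
Qed.

Lemma ffact_le_exp n m : (n ^_ m <= n ^ m)%N.
Proof.
elim: m => [|m IH]; first by rewrite ffactn0.
by rewrite ffactnSr expnSr leq_mul // leq_subr.
Qed.

Lemma bin_mul_wt_prod n m : 'C(n, m)%:R * wt_prod m = (n ^_ m)%:R / 2 ^+ 'C(m, 2).
Proof. by rewrite wt_prodE mulrA -natrM bin_ffact. Qed.

(** The last factor N - s times N + s + 1 is at most N^2 + N, and (N - 1)(N - 2)(N^2 + N) < N^4; the
    remaining factors are at most N. *)
Lemma ffact_mul_lt N s : (3 <= s)%N -> (s < N)%N ->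
  (N ^_ s.+1 * (N + s.+1) < N ^ s.+2)%N.
Proof.
case: s => [|[|[|m]]] // _ sN.
rewrite 3!ffactnS ffactnSr (_ : m.+3.+2 = m + 5)%N; last by lia.
rewrite expnD.
have F_le : ((N.-2.-1) ^_ m <= N ^ m)%N.
  apply: leq_trans (ffact_le_exp _ _) _.
  by case: m {sN} => // m; rewrite leq_exp2r //; lia.
have -> : (N * (N.-1 * (N.-2 * (N.-2.-1 ^_ m * (N.-2.-1 - m)))) * (N + m.+4) =
   N * (N.-1 * N.-2 * ((N.-2.-1 - m) * (N + m.+4))) * N.-2.-1 ^_ m)%N by ring.
have P_le : ((N.-2.-1 - m) * (N + m.+4) <= N ^ 2 + N)%N by nia.
have lt4 : (N.-1 * N.-2 * ((N.-2.-1 - m) * (N + m.+4)) < N ^ 4)%N.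
  have [M NE] : exists M, N = M.+4 by exists (N - 4)%N; lia.
  move: P_le; rewrite {sN F_le}NE /=; set P := (_ * _)%N.
  rewrite (expnD _ 2 2) -!mulnn => P_le.
  apply: (@leq_ltn_trans (M.+3 * M.+2 * (M.+4 * M.+4 + M.+4))%N).
    by rewrite leq_mul2l P_le orbT.
  by nia.
apply: (@leq_ltn_trans (N * (N.-1 * N.-2 * ((N.-2.-1 - m) * (N + m.+4))) * N ^ m)%N).
  by rewrite leq_mul2l F_le orbT.
rewrite mulnC ltn_pmul2l ?expn_gt0; last by lia.
by rewrite [(N ^ 5)%N]expnS ltn_pmul2l //; lia.
Qed.

(** With N = k + 1, the two terms combine to the falling factorial of order s + 1 times N + s + 1,
    over 2^C(s + 2, 2). Since s + 2 = 2b + 1, the denominator is (2^b)^(s + 2), at least N^(s +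
    2). *)
Lemma row_point_lt1 b k s : (2 <= b)%N -> (k < 2 ^ b)%N -> s.+1 = (2 * b)%N ->
  'C(k.+1, s.+2)%:R * wt_prod s.+2 + 'C(k.+1, s.+1)%:R * (wt_prod s.+1 * wt s) < 1.
Proof.
move=> b2 kb sE.
rewrite mulrA !bin_mul_wt_prod /wt.
have e2 : ('C(s.+2, 2) = 'C(s.+1, 2) + s.+1)%N by rewrite binS bin1.
have -> : (k.+1 ^_ s.+2)%:R / 2 ^+ 'C(s.+2, 2) +
     (k.+1 ^_ s.+1)%:R / 2 ^+ 'C(s.+1, 2) * (s.+1%:R / 2 ^+ s) =
     (k.+1 ^_ s.+2 + k.+1 ^_ s.+1 * (2 * s.+1))%:R / 2 ^+ 'C(s.+2, 2) :> rat.
  by rewrite e2 exprD exprS natrD !natrM; field; rewrite !expf_neq0.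
rewrite ltr_pdivrMr ?exprn_gt0 // mul1r -natrX ltr_nat ffactnSr -mulnDr.
have [lt_k|le_k] := ltnP k s; first by rewrite ffact_small ?mul0n ?expn_gt0.
rewrite (_ : k.+1 - s.+1 + 2 * s.+1 = k.+1 + s.+1)%N; last by lia.
have s3 : (3 <= s)%N by lia.
apply: leq_trans (ffact_mul_lt s3 (le_k : (s < k.+1)%N)) _.
have -> : ('C(s.+2, 2) = b * s.+2)%N by rewrite sE -addn1 bin2_odd.
by rewrite expnM leq_exp2r.
Qed.

Lemma row_sum_00 t c : row_sum 0 t 0 c = 'C(t, c)%:R * wt_prod c.
Proof.
elim: t c => [|t IH] [|c] /=; rewrite ?bin0 ?bin0n ?mul1r ?mul0r //.
- by rewrite /wt_prod big_ord0.
- by rewrite !addr0 IH bin0 mul1r.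
- rewrite !addr0 !IH binS natrD mulrDl wt_prodS addn0 mulrCA [wt c * _]mulrC; ring.
Qed.

Lemma linear_lt_expn2 b : (11 <= b -> 132 * b + 1 < 2 ^ b)%N.
Proof.
move/subnK<-; elim: (b - 11)%N => [|d IH] //.
by rewrite addSn expnS; lia.
Qed.

(** With n = a + c, the bound of [row_sum_le] becomes a falling factorial of 2^b + c of order n. The
    condition c <= a + 3 bounds it by (2^b + 2)^n, hence by 11/10 of (2^b)^n, and 44 is 40 times
    11/10. *)
Lemma row_term_le b a c e d : (11 <= b)%N -> (0 < a)%N -> (0 < c)%N ->
  (a + c = 4 * b - 1)%N -> (c <= a + 3)%N ->
  (b * (4 * b - 1) = 'C(a, 2) + 'C(c, 2) + e)%N ->
  (16 ^ b <= d * 'C(4 * b - 1, a))%N ->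
  wt_prod a * row_sum a (2 ^ b) a c <= 44 * (2 ^ e * d)%:R / 16 ^+ b.
Proof.
move=> b11 a0 c0 ac ca eE dE.
apply: le_trans (ler_wpM2l (ltW (wt_prod_gt0 a)) (row_sum_le (2 ^ b) a0 c0)) _.
rewrite ac; set n := (4 * b - 1)%N in ac eE dE *.
have C0 : (0 < 'C(n, a))%N by rewrite bin_gt0 -ac leq_addr.
have fE : (a`! * c`!)%:R = n`!%:R / 'C(n, a)%:R :> rat.
  have := @bin_fact n a; rewrite (_ : n - a = c)%N; last by lia.
  move=> /(_ _) E; rewrite -E; last by lia.
  by rewrite !natrM; field; rewrite pnatr_eq0 -lt0n.
have ff : (10 * (2 ^ b + c) ^_ n <= 11 * (2 ^ b) ^ n)%N.
  apply: leq_trans (expn_add2_le _); last first.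
    by have := linear_lt_expn2 b11; rewrite /n; lia.
  by rewrite leq_mul2l ffact_le_expn //; lia.
rewrite !wt_prodE.
have -> : a`!%:R / 2 ^+ 'C(a, 2) * (40 * (c`!%:R / 2 ^+ 'C(c, 2)) * 'C(2 ^ b + c, n)%:R)
   = 40 * ((2 ^ b + c) ^_ n)%:R / 'C(n, a)%:R / 2 ^+ ('C(a, 2) + 'C(c, 2)) :> rat.
  rewrite -bin_ffact natrM exprD.
  have -> : a`!%:R / 2 ^+ 'C(a, 2) * (40 * (c`!%:R / 2 ^+ 'C(c, 2)) * 'C(2 ^ b + c, n)%:R)
    = (a`! * c`!)%:R * (40 * 'C(2 ^ b + c, n)%:R) / 2 ^+ 'C(a, 2) / 2 ^+ 'C(c, 2) :> rat.
    by rewrite natrM; field; rewrite !expf_neq0.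
  by rewrite fE; field; rewrite !expf_neq0 // pnatr_eq0 -lt0n C0.
have p16 : 0 < 16 ^+ b :> rat by apply: exprn_gt0; rewrite ltr0n.
have p2 : 0 < 2 ^+ ('C(a, 2) + 'C(c, 2)) :> rat by apply: exprn_gt0; rewrite ltr0n.
have pC : 0 < 'C(n, a)%:R :> rat by rewrite ltr0n.
rewrite (ler_pdivlMr _ _ p16) mulrAC (ler_pdivrMr _ _ p2) mulrAC (ler_pdivrMr _ _ pC).
rewrite -!natrX -!natrM ler_nat.
have -> : (44 * (2 ^ e * d) * 2 ^ ('C(a, 2) + 'C(c, 2)) * 'C(n, a) =
     4 * (11 * (2 ^ b) ^ n) * (d * 'C(n, a)))%N.
  by rewrite -expnM eE [(2 ^ (_ + e))%N]expnD; ring.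
have -> : (40 * (2 ^ b + c) ^_ n * 16 ^ b = 4 * (10 * (2 ^ b + c) ^_ n) * 16 ^ b)%N by ring.
by rewrite leq_mul // leq_mul2l.
Qed.

(* Every pair of naturals with sum at least 4b - 1 dominates one of these. *)
Definition double_families b : seq (nat * nat) :=
  [:: (2 * b + 2, 0); (2 * b + 1, 2 * b - 2); (2 * b, 2 * b - 1);
      (2 * b - 1, 2 * b); (2 * b - 2, 2 * b + 1); (0, 2 * b + 2)]%N.

Lemma single_row_le b :
  'C(2 ^ b, 2 * b + 2)%:R * wt_prod (2 * b + 2) <= 1 / 2 / 2 ^+ b.
Proof.
rewrite bin_mul_wt_prod.
have -> : ('C(2 * b + 2, 2) = b * (2 * b + 2) + b + 1)%N.
  by rewrite (_ : 2 * b + 2 = 2 * b.+1)%N ?bin2_even; [ring|lia].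
have p2 : 0 < 2 ^+ (b * (2 * b + 2) + b + 1) :> rat by apply: exprn_gt0; rewrite ltr0n.
rewrite (ler_pdivrMr _ _ p2) !exprD expr1.
have -> : 1 / 2 / 2 ^+ b * (2 ^+ (b * (2 * b + 2)) * 2 ^+ b * 2) = (2 ^ (b * (2 * b + 2)))%:R :> rat.
  by rewrite natrX; field; rewrite expf_neq0.
by rewrite ler_nat expnM ffact_le_exp.
Qed.

Lemma double_families_lt1_large b : (11 <= b)%N ->
  \sum_(f <- double_families b) wt_prod f.1 * row_sum f.1 (2 ^ b) f.1 f.2 < 1.
Proof.
move=> b11.
have q0 : wt_prod 0 = 1 by rewrite /wt_prod big_ord0.
rewrite /double_families !big_cons big_nil [_.1]/= [_.2]/= row_sum0 row_sum_00 q0 [1 * _]mul1r addr0.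
rewrite [wt_prod (2 * b + 2) * _]mulrC.
have S := single_row_le b.
have symm i j : (i + j = 4 * b - 1)%N -> 'C(4 * b - 1, i) = 'C(4 * b - 1, j).
  by move=> ij; rewrite -bin_sub; [congr 'C(_, _)|]; lia.
have cent : (16 ^ b <= 2 * b * 'C(4 * b - 1, 2 * b))%N.
  apply: leq_trans (central_bin_ge _) _; first by lia.
  have := binS (4 * b - 1) (2 * b - 1); rewrite (symm (2 * b - 1)%N (2 * b)%N); last by lia.
  have e4 : (4 * b - 1).+1 = (4 * b)%N by lia.
  have e2 : (2 * b - 1).+1 = (2 * b)%N by lia.
  by rewrite e4 e2 => ->; lia.
have cent1 : (16 ^ b <= 2 * b * 'C(4 * b - 1, 2 * b - 1))%N.
  by rewrite (symm (2 * b - 1)%N (2 * b)%N) //; lia.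
have cent2 : (16 ^ b <= 4 * b * 'C(4 * b - 1, 2 * b + 1))%N.
  apply: leq_trans cent _.
  have := mul_bin_left (4 * b - 1) (2 * b).
  rewrite (_ : 4 * b - 1 - 2 * b = 2 * b - 1)%N ?addn1; last by lia.
  by nia.
have cent3 : (16 ^ b <= 4 * b * 'C(4 * b - 1, 2 * b - 2))%N.
  by rewrite (symm (2 * b - 2)%N (2 * b + 1)%N) //; lia.
have [p bE] : exists p, b = p.+2 by exists b.-2; lia.
have E1 : (b * (4 * b - 1) = 'C(2 * b + 1, 2) + 'C(2 * b - 2, 2) + (3 * b - 3))%N.
  rewrite (_ : 2 * b - 2 = 2 * p.+1)%N; last by lia.
  rewrite bin2_odd bin2_even (_ : 4 * b - 1 = 4 * p + 7)%N; last by lia.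
  by rewrite (_ : 3 * b - 3 = 3 * p + 3)%N bE; [ring|lia].
have E2 : (b * (4 * b - 1) = 'C(2 * b, 2) + 'C(2 * b - 1, 2) + (3 * b - 1))%N.
  rewrite (_ : 2 * b - 1 = 2 * p.+1 + 1)%N; last by lia.
  rewrite bin2_odd (_ : 4 * b - 1 = 4 * p + 7)%N; last by lia.
  by rewrite (_ : 3 * b - 1 = 3 * p + 5)%N bE ?bin2_even; [ring|lia].
have x16 : 16 ^+ b = 2 ^+ b * (2 ^+ (3 * b - 3) * 8) :> rat.
  have -> : 16 = 2 ^+ 4 :> rat by rewrite -natrX.
  have -> : 8 = 2 ^+ 3 :> rat by rewrite -natrX.
  by rewrite -exprM -!exprD; congr (_ ^+ _); lia.
have x2 : 2 ^+ (3 * b - 1) = 2 ^+ (3 * b - 3) * 4 :> rat.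
  have -> : 4 = 2 ^+ 2 :> rat by rewrite -natrX.
  by rewrite -exprD; congr (_ ^+ _); lia.
have n0 m : 2 ^+ m != 0 :> rat by rewrite expf_neq0 // pnatr_eq0.
have v1 : 44 * (2 ^ (3 * b - 3) * (4 * b))%:R / 16 ^+ b = 22 * (b%:R / 2 ^+ b) :> rat.
  by rewrite x16 !natrM natrX; field; rewrite !n0.
have v2 : 44 * (2 ^ (3 * b - 1) * (2 * b))%:R / 16 ^+ b = 44 * (b%:R / 2 ^+ b) :> rat.
  by rewrite x16 !natrM natrX x2; field; rewrite !n0.
have T1 : wt_prod (2 * b + 1) * row_sum (2 * b + 1) (2 ^ b) (2 * b + 1) (2 * b - 2) <= 22 * (b%:R / 2 ^+ b).
  by rewrite -v1; apply: (@row_term_le b _ _ _ _ b11); [lia..|exact: E1|exact: cent2].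
have T2 : wt_prod (2 * b) * row_sum (2 * b) (2 ^ b) (2 * b) (2 * b - 1) <= 44 * (b%:R / 2 ^+ b).
  by rewrite -v2; apply: (@row_term_le b _ _ _ _ b11); [lia..|exact: E2|exact: cent].
have T3 : wt_prod (2 * b - 1) * row_sum (2 * b - 1) (2 ^ b) (2 * b - 1) (2 * b) <= 44 * (b%:R / 2 ^+ b).
  by rewrite -v2; apply: (@row_term_le b _ _ _ _ b11); [lia..|rewrite [('C(_, _) + _)%N]addnC; exact: E2|exact: cent1].
have T4 : wt_prod (2 * b - 2) * row_sum (2 * b - 2) (2 ^ b) (2 * b - 2) (2 * b + 1) <= 22 * (b%:R / 2 ^+ b).
  by rewrite -v1; apply: (@row_term_le b _ _ _ _ b11); [lia..|rewrite [('C(_, _) + _)%N]addnC; exact: E1|exact: cent3].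
(* The four mixed terms contribute 22 + 44 + 44 + 22 = 132 times b / 2^b, and the two single-row
   terms at most 1 / 2^b together. *)
have fin : 132 * (b%:R / 2 ^+ b) + 1 / 2 ^+ b < 1 :> rat.
  have p2 : 0 < 2 ^+ b :> rat by apply: exprn_gt0; rewrite ltr0n.
  rewrite mulrA -mulrDl (ltr_pdivrMr _ _ p2) mul1r -natrM natr1 -natrX ltr_nat.
  by have := linear_lt_expn2 b11; rewrite addn1.
have half : 1 / 2 / 2 ^+ b = 1 / 2 * (1 / 2 ^+ b) :> rat by field; rewrite n0.
rewrite half in S.
have comb (R : realFieldType) (s t1 t2 t3 t4 x y : R) :
    s <= 1 / 2 * y -> t1 <= 22 * x -> t2 <= 44 * x -> t3 <= 44 * x -> t4 <= 22 * x ->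
    132 * x + y < 1 -> s + (t1 + (t2 + (t3 + (t4 + s)))) < 1 by lra.
exact: comb S T1 T2 T3 T4 fin.
Qed.

(** * Exact evaluation by Newton expansion for small b *)

Local Open Scope nat_scope.

(* The difference operator of [row_sum] in t, cleared of denominators. *)
Definition row_op (a : nat) (F : nat -> nat -> nat) (i j : nat) : nat :=
  (if i is i'.+1 then F i' j else 0) +
  (if j is j'.+1 then
     (j + (a - i)) * (2 ^ i * (F i j' + (if i is i'.+1 then F i' j' else 0)))
   else 0).

Definition delta00 (i j : nat) : nat := (i == 0) && (j == 0).

Fixpoint newton (a u : nat) : nat -> nat -> nat :=
  if u is u'.+1 then row_op a (newton a u') else delta00.

Fixpoint row_isum (a t : nat) : nat -> nat -> nat :=
  if t is t'.+1 then fun i j => row_isum a t' i j + row_op a (row_isum a t') i j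
  else delta00.

(** Passing from j to j + 1 raises the exponent by j + a. The denominator of [wt (j + (a - i))]
    takes up j + (a - i) of it, which leaves the factor [2 ^ i] in [row_op]. *)
Lemma row_isumE a t i j : i <= a ->
  ((row_isum a t i j)%:R = row_sum a t i j * 2 ^+ ('C(j, 2) + a * j) :> rat)%R.
Proof.
have n0 m : (2 ^+ m != 0 :> rat)%R by rewrite expf_neq0 // pnatr_eq0.
elim: t i j => [|t IH] i j ia.
  rewrite /= /delta00; case: i ia => [|i] _; case: j => [|j]; rewrite /= ?mul0r //.
  by rewrite muln0 addn0 expr0 mulr1.
rewrite /= /row_op natrD IH // -addrA mulrDl natrD; congr (_ + _)%R.
rewrite mulrDl; congr (_ + _)%R.
  by case: i ia => [|i] ia; rewrite ?mul0r // IH // ltnW.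
case: j => [|j]; first by rewrite mul0r.
have E : ((if i is i'.+1 then row_isum a t i' j else 0)%:R =
  (if i is i'.+1 then row_sum a t i' j else 0) * 2 ^+ ('C(j, 2) + a * j) :> rat)%R.
  by case: i ia => [|i] ia; rewrite ?mul0r // IH // ltnW.
rewrite natrM natrM !natrD natrX E IH //.
have e : 'C(j.+1, 2) + a * j.+1 = (j + (a - i)) + i + ('C(j, 2) + a * j).
  by rewrite binS bin1 mulnS; lia.
rewrite e (exprD _ (j + (a - i) + i)) (exprD _ (j + (a - i))) /wt -[(j + _).+1]addSn natrD; set x := row_sum _ _ _ _; set y := (if i is _.+1 then _ else _).
have := n0 (j + (a - i)); move: (2 ^+ (j + (a - i)))%R => P Pn0.
by field.
Qed.

Lemma eq_row_op a F G i j : (forall i j, F i j = G i j) -> row_op a F i j = row_op a G i j.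
Proof. by move=> FG; rewrite /row_op; case: i j => [|i] [|j]; rewrite ?FG. Qed.

Lemma row_op_sum a (c : nat -> nat) (F : nat -> nat -> nat -> nat) n i j :
  row_op a (fun i j => \sum_(u < n) c u * F u i j) i j =
  \sum_(u < n) c u * row_op a (F u) i j.
Proof.
elim: n => [|n IH]; first by rewrite /row_op; case: i j => [|i] [|j]; rewrite !big_ord0 ?muln0.
rewrite [RHS]big_ord_recr /= -IH /row_op.
by case: i {IH} => [|i]; case: j => [|j]; rewrite /= ?big_ord_recr /=; ring.
Qed.

(** [row_isum a t] arises from [delta00] by t applications of identity plus [row_op a], a linear
    operator, so the binomial theorem applies. *)
Lemma row_isum_newton a t n i j : t < n ->
  row_isum a t i j = \sum_(u < n) 'C(t, u) * newton a u i j.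
Proof.
elim: t n i j => [|t IH] [//|n] i j tn.
  by rewrite big_ord_recl /= bin0 mul1n big1 ?addn0.
rewrite /= (IH n) // (@eq_row_op _ _ (fun i j => \sum_(u < n) 'C(t, u) * newton a u i j)); last first.
  by move=> *; apply: IH.
rewrite row_op_sum; case: n tn => [//|n] tn.
rewrite [RHS]big_ord_recl bin0 big_ord_recl bin0 -addnA; congr (_ + _).
under [RHS]eq_bigr => u _ do rewrite lift0 binS mulnDl.
rewrite big_split /= ; congr (_ + _).
by rewrite big_ord_recr /= bin_small ?mul0n ?addn0 //.
Qed.

(** Each application of [row_op] uses up at least one unit of i + j. Hence i + j + 1 terms suffice,
    however large t is. *)
Lemma newton_eq0 a u i j : i + j < u -> newton a u i j = 0.
Proof.
elim: u i j => [//|u IH] i j iju /=; rewrite /row_op.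
case: i j iju => [|i] [|j] iju //; rewrite ?IH ?muln0 //; lia.
Qed.

Lemma row_isum_newton_trunc a t i j :
  row_isum a t i j = \sum_(u < (i + j).+1) 'C(t, u) * newton a u i j.
Proof.
rewrite (@row_isum_newton a t (maxn t (i + j)).+1) ?ltnS ?leq_maxl //.
rewrite -!(big_mkord xpredT (fun u => 'C(t, u) * newton a u i j)).
rewrite (big_cat_nat (n := (i + j).+1)) ?ltnS ?leq_maxr //=.
rewrite [X in _ + X]big_nat_cond [X in _ + X]big1 ?addn0 //.
by move=> u /andP[/andP[iju _] _]; rewrite newton_eq0 ?muln0.
Qed.

(** [prev] and [cur] are rows i - 1 and i from column j on, [m] is a - i, [p] is 2^i, and [s] is the
    sum of their entries in column j - 1, or 0 when j = 0. Binary numbers keep the evaluation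
    fast. *)
Fixpoint row_step (m p j s : N) (prev cur : seq N) : seq N :=
  match prev, cur with
  | x :: prev', y :: cur' =>
      (x + (j + m) * (p * s))%num :: row_step m p (j + 1)%num (y + x)%num prev' cur'
  | _, _ => [::]
  end.

Fixpoint table_step (m p : N) (prev : seq N) (tab : seq (seq N)) : seq (seq N) :=
  if tab is cur :: tab' then
    row_step m p 0%num 0%num prev cur :: table_step (m - 1)%num (p + p)%num cur tab'
  else [::].

Definition row_of (f : nat -> nat) (j n : nat) : seq N := [seq N.of_nat (f l) | l <- iota j n].

Definition table_of (F : nat -> nat -> nat) (c i n : nat) : seq (seq N) :=
  [seq row_of (F l) 0 c | l <- iota i n].

Lemma row_of0 j n : row_of (fun=> 0) j n = nseq n 0%num.
Proof. by elim: n j => [//|n IH] j; rewrite /= -(IH j.+1). Qed.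

Lemma table_of0 c i n : table_of (fun _ _ => 0) c i n = nseq n (nseq c 0%num).
Proof. by elim: n i => [//|n IH] i; rewrite /= -(IH i.+1) -(row_of0 0). Qed.

Lemma row_stepE m p f g j s n :
  s = (if j is j'.+1 then g j' + f j' else 0) ->
  row_step (N.of_nat m) (N.of_nat p) (N.of_nat j) (N.of_nat s) (row_of f j n) (row_of g j n) =
  row_of (fun l => f l + (l + m) * (p * (if l is l'.+1 then g l' + f l' else 0))) j n.
Proof.
elim: n j s => [//|n IH] j s sE; rewrite /row_of /= -sE; congr (_ :: _).
  by lia.
rewrite -/(row_of f j.+1 n) -/(row_of g j.+1 n).
have -> : (N.of_nat j + 1)%num = N.of_nat j.+1 by lia.
have -> : (N.of_nat (g j) + N.of_nat (f j))%num = N.of_nat (g j + f j) by lia.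
exact: IH.
Qed.

Lemma table_stepE a F c i n : i + n <= a.+1 ->
  table_step (N.of_nat (a - i)) (N.of_nat (2 ^ i))
    (row_of (if i is i'.+1 then F i' else fun=> 0) 0 c) (table_of F c i n) =
  table_of (row_op a F) c i n.
Proof.
elim: n i => [//|n IH] i ia; rewrite /table_of /=; congr (_ :: _).
  rewrite (@row_stepE _ _ _ _ 0 0) //; apply: eq_map => l.
  by congr N.of_nat; rewrite /row_op; case: i {ia} => [|i]; case: l => [|l]; rewrite ?muln0 ?addn0.
have -> : (N.of_nat (a - i) - 1)%num = N.of_nat (a - i.+1) by lia.
have -> : (N.of_nat (2 ^ i) + N.of_nat (2 ^ i))%num = N.of_nat (2 ^ i.+1) by rewrite expnS; lia.
by apply: (IH i.+1); lia.
Qed.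

(* With [bn] = 'C(t, u) and [tab] the table of the u-th difference, adds the
   next [fuel] terms of the Newton expansion. *)
Fixpoint newton_loop (a c : nat) (t : N) (fuel : nat) (u bn : N) (tab : seq (seq N)) : N :=
  if fuel is fuel'.+1 then
    (bn * nth 0%num (nth [::] tab a) c +
     newton_loop a c t fuel' (u + 1) (bn * (t - u) / (u + 1))
       (table_step (N.of_nat a) 1 (nseq c.+1 0) tab))%num
  else 0%num.

Lemma newton_loopE a c t fuel u :
  newton_loop a c (N.of_nat t) fuel (N.of_nat u) (N.of_nat 'C(t, u)) (table_of (newton a u) c.+1 0 a.+1) =
  N.of_nat (\sum_(u <= v < u + fuel) 'C(t, v) * newton a v a c).
Proof.
elim: fuel u => [|n IH] u; first by rewrite addn0 big_geq.
rewrite /newton_loop -/newton_loop big_ltn ?addnS ?ltnS ?leq_addr //.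
have -> : nth 0%num (nth [::] (table_of (newton a u) c.+1 0 a.+1) a) c = N.of_nat (newton a u a c).
  by rewrite (nth_map 0) ?size_iota // (nth_map 0) ?size_iota // !nth_iota.
have := @table_stepE a (newton a u) c.+1 0 a.+1 (leqnn _); rewrite subn0 expn0.
rewrite row_of0 => ->; rewrite -[row_op a (newton a u)]/(newton a u.+1).
have -> : (N.of_nat u + 1)%num = N.of_nat u.+1 by lia.
(* The division is exact: the numerator is [u.+1 * 'C(t, u.+1)]. *)
have -> : (N.of_nat 'C(t, u) * (N.of_nat t - N.of_nat u) / N.of_nat u.+1)%num = N.of_nat 'C(t, u.+1).
  rewrite -Nat2N.inj_sub -Nat2N.inj_mul.
  have -> : Nat.mul 'C(t, u) (Nat.sub t u) = u.+1 * 'C(t, u.+1) by rewrite mul_bin_left mulnC.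
  by rewrite Nat2N.inj_mul N.mul_comm N.div_mul.
rewrite IH addSn; lia.
Qed.

Fixpoint factN (n : nat) : N := if n is n'.+1 then (N.of_nat n * factN n')%num else 1%num.

Lemma factNE n : factN n = N.of_nat n`!.
Proof. by elim: n => [//|n IH]; rewrite factS /factN -/factN IH; lia. Qed.

Definition pair_num (t : N) (f : nat * nat) : N :=
  (factN f.1 * newton_loop f.1 f.2 t (f.1 + f.2).+1 0 1
     ((1 :: nseq f.2 0) :: nseq f.1 (nseq f.2.+1 0)))%num.

(** This equals C(a + c, 2) for [f = (a, c)], so all pairs of sum 4b - 1 share one denominator, the
    common one [E] in the check below. *)
Definition pair_exp (f : nat * nat) : nat := 'C(f.1, 2) + 'C(f.2, 2) + f.1 * f.2.

Lemma pair_numE t f : pair_num (N.of_nat t) f = N.of_nat (f.1`! * row_isum f.1 t f.1 f.2).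
Proof.
rewrite /pair_num factNE.
have -> : (1%num :: nseq f.2 0%num) :: nseq f.1 (nseq f.2.+1 0%num) = table_of (newton f.1 0) f.2.+1 0 f.1.+1.
  have rowS g n : row_of g 0 n.+1 = N.of_nat (g 0) :: row_of (fun l => g l.+1) 0 n.
    by rewrite /row_of /= -[in LHS](addn0 1) iotaDl -map_comp.
  have tabS G n m : table_of G m 0 n.+1 = row_of (G 0) 0 m :: table_of (fun l => G l.+1) m 0 n.
    by rewrite /table_of /= -[in LHS](addn0 1) iotaDl -map_comp.
  by rewrite tabS rowS -(table_of0 _ 0) -(row_of0 0).
have -> : 1%num = N.of_nat 'C(t, 0) by rewrite bin0.
rewrite (@newton_loopE _ _ _ _ 0) add0n big_mkord -row_isum_newton_trunc; lia.
Qed.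

Definition families_check (b : nat) : bool :=
  let E := pair_exp (2 * b, 2 * b - 1) in
  let t := (2 ^ N.of_nat b)%num in
  (foldr (fun f s => pair_num t f * 2 ^ N.of_nat (E - pair_exp f) + s) 0 (double_families b)
     <? 2 ^ N.of_nat E)%num && all (fun f => pair_exp f <= E) (double_families b).

Lemma wt_prod_row_sumE t f :
  (wt_prod f.1 * row_sum f.1 t f.1 f.2 =
   (f.1`! * row_isum f.1 t f.1 f.2)%:R / 2 ^+ pair_exp f)%R.
Proof.
have n0 m : (2 ^+ m != 0 :> rat)%R by rewrite expf_neq0 // pnatr_eq0.
rewrite wt_prodE natrM row_isumE // /pair_exp -addnA (exprD _ 'C(f.1, 2)).
by field; rewrite !n0.
Qed.

Lemma families_checkP b : families_check b ->
  (\sum_(f <- double_families b) wt_prod f.1 * row_sum f.1 (2 ^ b) f.1 f.2 < 1)%R.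
Proof.
rewrite /families_check; set E := pair_exp (2 * b, 2 * b - 1).
case/andP=> /N.ltb_lt lt_E le_E.
have e2 m : (2 ^ N.of_nat m)%num = N.of_nat (2 ^ m).
  by elim: m => [//|m IH]; rewrite Nat2N.inj_succ N.pow_succ_r' IH expnS; lia.
have p2 : (0 < 2 ^+ E :> rat)%R by rewrite exprn_gt0 ?ltr0n.
rewrite -(ltr_pM2r p2) mul1r mulr_suml.
have -> : (\sum_(f <- double_families b) wt_prod f.1 * row_sum f.1 (2 ^ b) f.1 f.2 * 2 ^+ E =
   (\sum_(f <- double_families b) f.1`! * row_isum f.1 (2 ^ b) f.1 f.2 * 2 ^ (E - pair_exp f))%:R :> rat)%R.
  rewrite natr_sum big_seq [RHS]big_seq; apply: eq_bigr => f /(allP le_E) fE.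
  rewrite wt_prod_row_sumE -{1}(subnK fE) exprD [(_ * 2 ^ _)%:R%R]natrM natrX.
  by field; rewrite expf_neq0 // pnatr_eq0.
rewrite -natrX ltr_nat.
suff sumE r : foldr (fun f s => (pair_num (2 ^ N.of_nat b) f * 2 ^ N.of_nat (E - pair_exp f) + s)%num) 0%num r
    = N.of_nat (\sum_(f <- r) f.1`! * row_isum f.1 (2 ^ b) f.1 f.2 * 2 ^ (E - pair_exp f)).
  by move: lt_E; rewrite sumE e2; lia.
elim: r => [|f r IH]; first by rewrite big_nil.
by rewrite big_cons /= IH !e2 pair_numE; lia.
Qed.

Lemma double_families_lt1 b : 2 <= b ->
  (\sum_(f <- double_families b) wt_prod f.1 * row_sum f.1 (2 ^ b) f.1 f.2 < 1)%R.
Proof.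
move=> b2; have [b11|b11] := leqP 11 b; first exact: double_families_lt1_large.
(* These are the values b = 2, ..., 10. *)
have chk : all families_check (iota 2 9) by vm_compute.
by apply: families_checkP; apply: (allP chk); rewrite mem_iota; lia.
Qed.

(** * From small triangle-free sets to digraphs of bounded treewidth *)

(* Acyclicity is only used through the absence of directed triangles. *)
Definition small_triangle_free (k n beta : nat) (arc : rel nat) : Prop :=
  [/\ irreflexive arc, forall x y, arc x y -> ~~ arc y x,
      forall x y, arc x y -> (x <= y + k) && (y <= x + k)
    & forall S : pred nat, triangle_free arc S n -> count S (iota 0 n) <= beta].

Lemma small_triangle_free1 k : small_triangle_free k 1 1 (fun _ _ => false).
Proof. by split=> // S _ /=; case: (S 0). Qed.

Definition glue (n1 : nat) (a1 a2 : rel nat) : rel nat := fun x y =>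
  if (x < n1) && (y < n1) then a1 x y
  else [&& n1 <= x, n1 <= y & a2 (x - n1) (y - n1)].

Lemma small_triangle_free_glue k n1 n2 b1 b2 a1 a2 :
  small_triangle_free k n1 b1 a1 -> small_triangle_free k n2 b2 a2 ->
  small_triangle_free k (n1 + n2) (b1 + b2) (glue n1 a1 a2).
Proof.
move=> [irr1 asym1 near1 tf1] [irr2 asym2 near2 tf2]; split.
- by move=> x; rewrite /glue; case: ifP => _; rewrite ?irr1 // irr2 !andbF.
- move=> x y; rewrite /glue [(y < n1) && _]andbC; case: ifP => _; first exact: asym1.
  by move/and3P=> [-> -> /asym2].
- move=> x y; rewrite /glue; case: ifP => _; first exact: near1.
  by move/and3P=> [xn yn /near2]; lia.
- move=> S /triangle_freeP tf; rewrite iotaD count_cat; apply: leq_add.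
    apply: tf1; apply/triangle_freeP=> x y z xn yn zn Sx Sy Sz axy ayz.
    have := tf x y z (ltn_addr _ xn) (ltn_addr _ yn) (ltn_addr _ zn) Sx Sy Sz.
    by rewrite /glue xn yn zn /=; apply.
  rewrite -[iota (0 + n1) n2]/(iota n1 n2) -[n1 in iota n1 n2]addn0 iotaDl count_map; apply: tf2.
  apply/triangle_freeP=> x y z xn yn zn Sx Sy Sz axy ayz.
  have := tf (n1 + x) (n1 + y) (n1 + z).
  rewrite !ltn_add2l /glue ![n1 + _ < n1]ltnNge !leq_addr /= !addKn.
  by apply.
Qed.

Lemma small_triangle_free_iter k n1 n2 b1 b2 a1 a2 h :
  small_triangle_free k n1 b1 a1 -> small_triangle_free k n2 b2 a2 ->
  small_triangle_free k (h * n2 + n1) (h * b2 + b1) (iter h (glue n2 a2) a1).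
Proof.
move=> H1 H2; elim: h => [|h IH] //=.
by rewrite !mulSn -!addnA; apply: small_triangle_free_glue.
Qed.

(** In the natural order, the earlier neighbours of v are the last min(k, v) vertices before it,
    pairwise at distance less than k. *)
Lemma is_ktree_path_power k n :
  @is_ktree k n (fun x y : 'I_n => [&& x != y, x <= y + k & y <= x + k]).
Proof.
split=> [x|]; first by rewrite eqxx.
split=> [x y|]; first by rewrite eq_sym andbA andbAC -andbA.
exists 1%g => v; split=> [a b|].
  by rewrite !inE !perm1 -!val_eqE /=; lia.
rewrite perm1 cardE -sum1_size big_filter.
rewrite (eq_bigl (fun u : 'I_n => (u < v) && (v <= u + k))); last first.
  by move=> u; rewrite !inE !perm1 -!val_eqE /=; lia.
rewrite -(big_mkord (fun u => (u < v) && (v <= u + k)) (fun=> 1)).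
rewrite (big_cat_nat (n := v)) //=; last exact: ltnW.
rewrite [X in _ + X]big_nat_cond [X in _ + X]big1 ?addn0; last by move=> u; lia.
rewrite (big_cat_nat (n := v - k)) ?leq_subr //=.
rewrite big_nat_cond big1 ?add0n; last by move=> u; lia.
rewrite big_nat_cond (eq_bigl (fun u => (v - k <= u < v) && true)); last first.
  by move=> u; lia.
by rewrite -big_nat_cond sum_nat_const_nat muln1; lia.
Qed.

Lemma fvs_number_ge (T : finType) (arc : rel T) beta :
  (forall F, fvsb arc F -> #|T| - beta <= #|F|) -> #|T| - beta <= fvs_number arc.
Proof.
(* The default value [#|T|] of the minimum also has to satisfy the bound. *)
move=> H; rewrite /fvs_number; elim/big_rec: _ => [|F x FF Hx]; first exact: leq_subr.
by rewrite leq_min Hx H.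
Qed.

(** The complement of a feedback vertex set has no directed triangle, so it has at most [beta]
    vertices. *)
Lemma small_triangle_free_digraph k n beta (arc : rel nat) (D : rel 'I_n := fun x y => arc x y) :
  small_triangle_free k n beta arc ->
  [/\ oriented D, tw_le k D & n - beta <= fvs_number D].
Proof.
move=> [irr asym near tf]; split.
- by split=> [x|x y]; rewrite /D ?irr; last exact: asym.
- exists n, id, (fun x y : 'I_n => [&& x != y, x <= y + k & y <= x + k]).
  split=> //; split; first exact: is_ktree_path_power.
  move=> x y axy; rewrite near // andbT; move: axy; rewrite /D => axy.
  by apply: contraL axy => /eqP ->; rewrite irr.
- have := @fvs_number_ge 'I_n D beta; rewrite card_ord; apply=> F fF.
  pose S : pred nat := fun v => if insub v is Some u then (u : 'I_n) \notin F else false.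
  have SE (u : 'I_n) : S u = (u \notin F) by rewrite /S valK.
  have : count S (iota 0 n) = #|~: F|.
    rewrite -val_enum_ord count_map cardE size_filter -enumT /=.
    by apply: eq_count => u; rewrite /= SE !inE.
  move=> cS; suff : count S (iota 0 n) <= beta.
    by have := cardsC F; rewrite cS card_ord; lia.
  apply: tf.
  apply/triangle_freeP=> x y z xn yn zn.
  rewrite -[x]/(val (Ordinal xn)) -[y]/(val (Ordinal yn)) -[z]/(val (Ordinal zn)).
  move: (Ordinal xn) (Ordinal yn) (Ordinal zn) => {xn yn zn} {}x {}y {}z.
  rewrite /= !SE -![arc _ _]/(D _ _) => Sx Sy Sz axy ayz; apply/negP=> azx; move/negP: fF; apply.
  apply/existsP; exists x; apply/existsP; exists y.
  rewrite /induced /= axy !inE Sx Sy /=.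
  by apply: (@connect_trans _ _ z); apply: connect1; rewrite /= !inE ?ayz ?azx ?Sx ?Sy ?Sz.
Qed.

Lemma orient_rel_small_triangle_free k n beta o :
  (forall T, triangle_free (orient_rel k o) T n -> count T (iota 0 n) <= beta) ->
  small_triangle_free k n beta (orient_rel k o).
Proof.
rewrite /orient_rel => tf; split=> [x|x y|x y|//]; first by rewrite ltnn.
  by case: ltngtP => //= _; case: (o _ _); rewrite ?andbF ?orbF //= andbF.
by case/orP=> /and3P[lt le _]; lia.
Qed.

Lemma row_point_small_triangle_free k b : 2 <= b -> k < 2 ^ b ->
  exists arc, small_triangle_free k (k + 2) (2 * b) arc.
Proof.
move=> b2 kb; have sE : (2 * b - 1).+1 = 2 * b by lia.
have [o Ho] := first_moment_row_point (row_point_lt1 b2 kb sE).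
exists (orient_rel k o); apply: orient_rel_small_triangle_free => T.
rewrite (_ : k + 2 = k.+1 + 1)%N; last by lia.
by move/Ho; rewrite sE ltnS.
Qed.

Lemma two_rows_small_triangle_free k b : 2 <= b -> k < 2 ^ b ->
  exists arc, small_triangle_free k (k.+1 + k.+1) (4 * b - 2) arc.
Proof.
move=> b2 kb.
have [|o Ho] := @first_moment_two_rows k (double_families b).
  (* The sums grow with the number of columns, so k + 1 <= 2^b reduces to exactly 2^b columns. *)
  apply: le_lt_trans (double_families_lt1 b2); apply: ler_sum => f _.
  by apply: ler_wpM2l (row_sum_mono _ _ _ kb); apply/ltW/wt_prod_gt0.
exists (orient_rel k o); apply: orient_rel_small_triangle_free => T /Ho {}Ho.
have in_r f : f \in double_families b -> _ := Ho f.
move: (in_r (2 * b + 2, 0)) (in_r (2 * b + 1, 2 * b - 2)) (in_r (2 * b, 2 * b - 1))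
      (in_r (2 * b - 1, 2 * b)) (in_r (2 * b - 2, 2 * b + 1)) (in_r (0, 2 * b + 2)).
rewrite !inE !eqxx !orbT iotaD count_cat add0n.
move=> /(_ isT) H1 /(_ isT) H2 /(_ isT) H3 /(_ isT) H4 /(_ isT) H5 /(_ isT) H6.
by move: (count T (iota 0 _)) (count T (iota k.+1 _)) H1 H2 H3 H4 H5 H6 => x y /=; lia.
Qed.

Theorem mainTheorem8 (k : nat) (hk : 2 <= k) :
  exists D : forall i : nat, rel 'I_(k + 2 + i * (k + 1)),
    forall i : nat,
      oriented (D i) /\ tw_le k (D i) /\
      #|'I_(k + 2 + i * (k + 1))| = k + 2 + i * (k + 1) /\
      (i + 1) * (k - 2 * trunc_log 2 k) <= fvs_number (D i).
Proof.
set l := trunc_log 2 k.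
have l1 : 1 <= l by apply: trunc_log_max.
have kl : k < 2 ^ l.+1 by apply: trunc_log_ltn.
have [a1 H1] := @row_point_small_triangle_free k l.+1 l1 kl.
have [a2 H2] := @two_rows_small_triangle_free k l.+1 l1 kl.
(* There are 1 + (i + 1)(k + 1) vertices. Double pieces have 2(k + 1) vertices and bound 2(2l + 1).
   The remainder is one vertex with bound 1 for odd i, and k + 2 vertices with bound 1 + (2l + 1)
   for even i. *)
pose a i := if odd i then iter i.+1./2 (glue (k.+1 + k.+1) a2) (fun _ _ => false)
            else iter i./2 (glue (k.+1 + k.+1) a2) a1.
have H i : small_triangle_free k (k + 2 + i * (k + 1)) (1 + (i + 1) * (2 * l + 1)) (a i).
  rewrite /a; have iE := odd_double_half i; case: ifP iE => oi iE.
    have := small_triangle_free_iter i.+1./2 (small_triangle_free1 k) H2.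
    have := odd_double_half i.+1; rewrite /= oi /= => iE'.
    by congr small_triangle_free; nia.
  have := small_triangle_free_iter i./2 H1 H2.
  by congr small_triangle_free; nia.
exists (fun i x y => a i x y) => i; have [o t f] := small_triangle_free_digraph (H i).
split=> //; split=> //; rewrite card_ord; split=> //.
by apply: leq_trans f; rewrite mulnBr; nia.
Qed.
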